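(* Let $R$ be an integral domain and let $M$ be a nonzero, non-simple multiplication $R$-module such that $\operatorname{ann}(M)$ is a prime ideal of $R$. Then $D(M)$ is an ultraconnected space. In particular, $D(M)$ is a $T_4$-space.
   Context: For $m,n\in M$ write $m\mid n$ if $n=rm$ for some $r\in R$ (equivalently $Rn\subseteq Rm$). Put $M^{\#}=\{0\neq m\in M: Rm\neq M\}$ and define an equivalence relation on $M^{\#}$ by $m\sim n$ iff $Rm=Rn$; let $[m]$ be the class of $m$ and $\operatorname{EC}(M^{\#})=\{[m]:m\in M^{\#}\}$. For $m\in M^{\#}$ let $U_m=\{[n]\in \operatorname{EC}(M^{\#}): n\mid m\}$. The family $\{U_m\}_{m\in M^{\#}}$ is a basis of a topology on $\operatorname{EC}(M^{\#})$, called the divisor topology of $M$ and denoted $D(M)$ (also denoting the resulting space). $M$ is a multiplication module if each submodule $N$ of $M$ has the form $N=IM$ for some ideal $I$ of $R$. $\operatorname{ann}(M)=\{r\in R: rM=0\}$. A topological space is ultraconnected if any two nonempty closed sets have nonempty intersection. It is a $T_4$-space if any two disjoint closed sets are contained in disjoint open sets (no $T_1$ assumption is included). *)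

(* Defs.v *)
From HB Require Import structures.
From mathcomp Require Import all_boot all_order all_algebra ring_quotient.
From mathcomp Require Import generic_quotient.
From mathcomp Require Import boolp classical_sets topology.

Set Implicit Arguments.
Unset Strict Implicit.
Unset Printing Implicit Defensive.

Import GRing.Theory.
Local Open Scope classical_set_scope.
Local Open Scope ring_scope.
Local Open Scope quotient_scope.

Section Modules.
Context {R : idomainType}.
Implicit Types (M : lmodType R).

Definition is_submodule M (N : set M) : Prop := submod_closed (mem N).

(* The library's [idealr_closed] describes proper ideals only; here an ideal is
   a submodule of the regular module, possibly all of R. *)
Definition is_ideal (I : set R) : Prop := @is_submodule R^o I.

Definition is_prime_ideal (P : set R) : Prop :=
  idealr_closed (mem P) /\ prime_idealr_closed (mem P).

Definition ideal_mul M (I : set R) : set M :=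
  [set x | exists (n : nat) (a : 'I_n -> R) (m : 'I_n -> M),
    (forall i, I (a i)) /\ x = \sum_(i < n) a i *: m i].
Arguments ideal_mul M I : clear implicits.

Definition nonzero_module M : Prop := exists m : M, m != 0.

Definition simple_module M : Prop :=
  nonzero_module M /\
  forall N : set M, is_submodule N -> N = [set 0] \/ N = setT.

Definition multiplication_module M : Prop :=
  forall N : set M, is_submodule N ->
    exists2 I : set R, is_ideal I & N = ideal_mul M I.

Definition ann M : set R := [set r | forall m : M, r *: m = 0].
Arguments ann : clear implicits.

Definition cyclic_submodule M (m : M) : set M := [set r *: m | r in [set: R]].

Definition divides M (m n : M) : Prop := exists r : R, n = r *: m.

Definition sharp M : set M := [set m | m != 0 /\ cyclic_submodule m <> setT].
Arguments sharp : clear implicits.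

Definition same_span M (m n : set_type (sharp M)) : bool :=
  `[< cyclic_submodule (val m) = cyclic_submodule (val n) >].

Lemma divides_refl M (m : M) : divides m m.
Proof. by exists 1; rewrite scale1r. Qed.

Lemma divides_trans M (m n p : M) : divides m n -> divides n p -> divides m p.
Proof. by move=> [r ->] [s ->]; exists (s * r); rewrite scalerA. Qed.

Lemma cyclic_submodule_divides M (m n : M) :
  cyclic_submodule m = cyclic_submodule n -> divides m n.
Proof.
move=> e; have : cyclic_submodule n n by exists 1 => //; rewrite scale1r.
by rewrite -e => -[r _ <-]; exists r.
Qed.

Lemma same_span_refl M : reflexive (@same_span M).
Proof. by move=> m; exact/asboolP. Qed.

Lemma same_span_sym M : symmetric (@same_span M).
Proof. by move=> m n; apply/asboolP/asboolP => ->. Qed.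

Lemma same_span_trans M : transitive (@same_span M).
Proof. by move=> n m p /asboolP mn /asboolP np; apply/asboolP; rewrite mn. Qed.

Canonical same_span_equiv M := EquivRel (@same_span M)
  (@same_span_refl M) (@same_span_sym M) (@same_span_trans M).

End Modules.

Arguments sharp {R} M.
Arguments ann {R} M.
Arguments ideal_mul {R} M I.

Section DivisorTopology.
Context {R : idomainType} (M : lmodType R).

(* EC(M^#), with M^# rendered as [sharp M]; it also carries the divisor topology defined below; the class
   [m] is [\pi_(divisor_space M) m]. *)
Definition divisor_space : Type := {eq_quot @same_span R M}.
HB.instance Definition _ := Choice.on divisor_space.
HB.instance Definition _ := EqQuotient.on divisor_space.

Definition divU (m : set_type (sharp M)) : set divisor_space :=
  [set \pi_divisor_space n | n in [set n | divides (val n) (val m)]].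

Lemma divU_cover : \bigcup_(A in range divU) A = setT.
Proof.
rewrite eqEsubset; split => // c _; exists (divU (repr c)); first by exists (repr c).
by exists (repr c); [exact: divides_refl|rewrite reprK].
Qed.

Lemma divU_join (A B : set divisor_space) (c : divisor_space) :
  range divU A -> range divU B -> A c -> B c ->
  exists C, [/\ range divU C, C c & C `<=` A `&` B].
Proof.
move=> [a _ <-] [b _ <-] [m ma mc] [n nb nc].
have /eqmodP/asboolP/cyclic_submodule_divides mn :
    m = n %[mod_eq same_span_equiv M].
  by rewrite -[LHS]/(\pi_divisor_space m) mc -nc.
exists (divU m); split; first by exists m.
  by exists m => //; exact: divides_refl.
move=> _ [p pm <-]; split; exists p => //; first exact: divides_trans pm ma.
exact: divides_trans (divides_trans pm mn) nb.
Qed.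
HB.instance Definition _ := isBaseTopological.Build divisor_space
  divU_cover divU_join.

Lemma open_divisor_spaceE (A : set divisor_space) :
  open A <-> exists D : set (set_type (sharp M)), A = \bigcup_(m in D) divU m.
Proof.
split=> [[D sD <-]|[D ->]].
  exists [set m | D (divU m)]; rewrite eqEsubset; split=> c.
    by move=> [B DB Bc]; have [m _ mB] := sD _ DB; exists m; rewrite //= mB.
  by move=> [m /= Dm mc]; exists (divU m).
exists (divU @` D); first by move=> _ [m _ <-]; exists m.
by rewrite bigcup_image.
Qed.

End DivisorTopology.

Definition ultraconnected_space (T : topologicalType) : Prop :=
  forall A B : set T, closed A -> closed B ->
    A !=set0 -> B !=set0 -> A `&` B !=set0.

Definition T4_space (T : topologicalType) : Prop :=
  forall A B : set T, closed A -> closed B -> A `&` B = set0 ->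
    exists U V : set T,
      [/\ open U, open V, A `<=` U, B `<=` V & U `&` V = set0].

(* Main.v *)
(* If Rm = IM and Rn = JM are nonzero, then I and J contain a and b outside the
   prime ideal ann(M), so ab.x <> 0 for some x; this element lies in Rm and in
   Rn.  Closed sets of D(M) are stable under multiples, hence any two nonempty
   ones share the class of such a common multiple. *)
Require Import Defs.
From mathcomp Require Import all_boot all_order all_algebra.
From mathcomp Require Import boolp classical_sets topology.
From mathcomp Require Import generic_quotient.

Set Implicit Arguments.
Unset Strict Implicit.
Unset Printing Implicit Defensive.

Import GRing.Theory.
Local Open Scope classical_set_scope.
Local Open Scope ring_scope.
Local Open Scope quotient_scope.

Section CommonMultiples.
Context {R : idomainType} (M : lmodType R).

Lemma cyclic_submodule_is_submodule (m : M) :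
  is_submodule (cyclic_submodule m).
Proof.
split; first by apply/mem_set; exists 0 => //; rewrite scale0r.
move=> a _ _ /set_mem[r _ <-] /set_mem[s _ <-]; apply/mem_set.
by exists (a * r + s) => //; rewrite scalerDl scalerA.
Qed.

Lemma cyclic_submoduleE (m n : M) : cyclic_submodule m n <-> divides m n.
Proof. by split=> [[r _ <-]|[r ->]]; exists r. Qed.

Lemma ideal_mul_scale (I : set R) (a : R) (x : M) :
  I a -> ideal_mul M I (a *: x).
Proof.
by move=> Ia; exists 1%N, (fun=> a), (fun=> x); split=> //; rewrite big_ord1.
Qed.

(** Write [Rm = IM]. As [m] lies in [IM], it is a finite sum of terms [a i *: x i] with [a i] in
    [I]. If every [a i] annihilated [M], the sum would vanish; so some [a i] does not, and it sends
    [M] into [IM = Rm]. *)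
Lemma exists_scaling_divisible (M_mult : multiplication_module M) (m : M) :
  m != 0 -> exists2 a : R, ~ ann M a & forall x : M, divides m (a *: x).
Proof.
move=> m0; have [I _ mI] := M_mult _ (cyclic_submodule_is_submodule m).
have [k [a [x [Ia mE]]]] : ideal_mul M I m.
  by rewrite -mI; apply/cyclic_submoduleE/divides_refl.
have [i ai] : exists i, ~ ann M (a i).
  apply: contrapT => /forallNP annIa; move/eqP: m0; apply.
  by rewrite mE big1 // => i _; apply: (contrapT (annIa i)).
exists (a i) => // y; apply/cyclic_submoduleE; rewrite mI.
exact: ideal_mul_scale.
Qed.

Lemma nonzero_common_multiple (M_mult : multiplication_module M)
    (annM_prime : is_prime_ideal (ann M)) (m n : M) :
  m != 0 -> n != 0 -> exists k : M, [/\ k != 0, divides m k & divides n k].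
Proof.
move=> /(exists_scaling_divisible M_mult)[a aN ma].
move=> /(exists_scaling_divisible M_mult)[b bN nb].
have abN : ~ ann M (a * b).
  by move=> /mem_set/annM_prime.2/orP[]/set_mem.
have [x /eqP abx] : exists x, ~ ((a * b) *: x = 0 :> M) by apply/existsNP.
(* By commutativity [(a * b) *: x] is both [a *: (b *: x)], a multiple of [m], and [b *: (a *: x)],
   a multiple of [n]. *)
exists ((a * b) *: x); split=> //; first by rewrite -scalerA.
by rewrite mulrC -scalerA.
Qed.

(** [Rk] is contained in [Rm], so it is proper when [Rm] is. *)
Lemma sharp_divides (m k : M) : sharp M m -> divides m k -> k != 0 -> sharp M k.
Proof.
move=> [_ mT] mk k0; split=> // kT; apply: mT.
rewrite -subTset -kT => y /cyclic_submoduleE ky.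
exact/cyclic_submoduleE/(divides_trans mk).
Qed.

(** Every open set is a union of sets [divU p], each stable under passing to divisors; complements
    are therefore stable under passing to multiples. *)
Lemma closed_divides (A : set (divisor_space M)) (m k : set_type (sharp M)) :
  closed A -> divides (val m) (val k) ->
  A (\pi_(divisor_space M) m) -> A (\pi_(divisor_space M) k).
Proof.
move=> cA mk Am; apply: contrapT => Ak.
have /open_divisor_spaceE[D AD] := closed_openC cA.
have : (~` A) (\pi_(divisor_space M) k) by [].
rewrite AD => -[p Dp [n np nk]].
(* Membership of the class of [k] in [divU p] only provides some representative [n] dividing [p];
   equal spans give the chain [m | k | n | p]. *)
have /eqmodP/asboolP/esym/cyclic_submodule_divides kn :
  n = k %[mod_eq same_span_equiv M] by exact: nk.
suff : (~` A) (\pi_(divisor_space M) m) by apply.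
rewrite AD; exists p => //; exists m => //.
exact: divides_trans mk (divides_trans kn np).
Qed.

Lemma ultraconnected_divisor_space (M_mult : multiplication_module M)
    (annM_prime : is_prime_ideal (ann M)) :
  ultraconnected_space (divisor_space M).
Proof.
move=> A B cA cB [c Ac] [d Bd].
rewrite -[c]reprK in Ac; rewrite -[d]reprK in Bd.
have mS : sharp M (val (repr c)) := set_valP (repr c).
have nS : sharp M (val (repr d)) := set_valP (repr d).
have [k [k0 mk nk]] := nonzero_common_multiple M_mult annM_prime mS.1 nS.1.
(* The common multiple must be a point of the space: it is nonzero, and its span is proper because
   it is a multiple of [repr c]. *)
pose k' : set_type (sharp M) := SigSub (mem_set (sharp_divides mS mk k0)).
exists (\pi_(divisor_space M) k').
by split; [exact: closed_divides Ac|exact: closed_divides Bd].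
Qed.

End CommonMultiples.

(** Of two disjoint closed sets one must be empty, and then the empty set and the whole space
    separate them. *)
Lemma ultraconnected_T4 (T : topologicalType) :
  ultraconnected_space T -> T4_space T.
Proof.
move=> uT A B cA cB AB0.
have [A0|/set0P A0] := eqVneq A set0.
  exists set0, setT; rewrite A0 set0I.
  by split=> //; [exact: open0|exact: openT].
have [B0|/set0P B0] := eqVneq B set0.
  exists setT, set0; rewrite B0 setI0.
  by split=> //; [exact: openT|exact: open0].
by have [x] := uT _ _ cA cB A0 B0; rewrite AB0.
Qed.

Theorem proposition7 (R : idomainType) (M : lmodType R)
    (M_nonzero : nonzero_module M) (M_nonsimple : ~ simple_module M)
    (M_mult : multiplication_module M) (annM_prime : is_prime_ideal (ann M)) :
  ultraconnected_space (divisor_space M) /\ T4_space (divisor_space M).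
Proof.
have uM := ultraconnected_divisor_space M_mult annM_prime.
by split=> //; exact: ultraconnected_T4.
Qed.
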